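(* Let $G$ be a triangle-free graph on $n$ vertices with minimum degree at least $\frac{5}{14}n$. Then $G$ contains a set of $\lfloor n/2\rfloor$ vertices that spans at most $n^2/50$ edges. *)

(* Defs.v *)
From HB Require Import structures.
From mathcomp Require Import all_boot all_order all_algebra.
Set Implicit Arguments.
Unset Strict Implicit.
Unset Printing Implicit Defensive.
Import Order.TTheory GRing.Theory Num.Theory.

Record sgraph (T : finType) := SGraph {
  adj :> rel T;
  adj_sym : symmetric adj;
  adj_irr : irreflexive adj
}.

Section Graph.
Variables (T : finType) (G : sgraph T).

Definition neighbours (v : T) : {set T} := [set w | G v w].

Definition degree (v : T) : nat := #|neighbours v|.

Definition min_degree_ge (d : rat) : Prop :=
  forall v : T, (d <= (degree v)%:R)%R.

Definition triangle_free : Prop :=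
  forall x y z : T, ~~ [&& G x y, G y z & G z x].

Definition edges_in (S : {set T}) : {set {set T}} :=
  [set [set x; y] | x in S, y in S & G x y].

End Graph.

(* Main.v *)
Require Import Defs.
From HB Require Import structures.
From mathcomp Require Import all_boot all_order all_algebra.
From mathcomp Require Import zify.
From Stdlib Require Import Classical.
Set Implicit Arguments.
Unset Strict Implicit.
Unset Printing Implicit Defensive.
Import Order.TTheory GRing.Theory Num.Theory.

(** Adding edges only makes the problem harder, so let G be edge-maximal
    triangle-free: non-adjacent vertices have a common neighbour. Averaging
    degrees over small configurations then shows that even every independent
    triple has a common neighbour, and that if k <= 4 is maximal such that G
    contains the Andrasfai graph on Z/(3k-1), in which i ~ j iff j - i lies in
    [k, 2k-1], then every vertex of G sees exactly k of its vertices. Counting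
    degrees gives the same for k = 5, so for some k <= 5 the graph G maps
    homomorphically to that Andrasfai graph. In the resulting cyclic order of
    the colour classes, k consecutive classes form an independent set, namely a
    neighbourhood, and some arc of n/2 vertices starting with a full class spans
    at most n^2/50 edges: this is AM-GM for k = 2, while for k >= 3 every class
    has at least n/14 vertices because three neighbourhoods cover the circle
    with only one class covered twice. *)

(** * Refuting configurations *)

(** A configuration consists of vertices x_0, ..., x_(m-1) of G, pairs [E] of
    adjacent ones, pairs [N] of non-adjacent ones, and sets [F] of vertices
    without a common neighbour. [Count c]: each vertex of G has a c-weighted
    number of neighbours among the x_i below 5/14 of the total weight.
    [Hit v]: x_v is adjacent to all of a set in [F]. [Target s]: the forbidden
    graph [K] appears on the vertices listed in [s]. [Cut s]: either a new
    vertex x_m is adjacent to all of [s], or [s] joins [F]. [Branch i j]: x_i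
    and x_j are adjacent or not. [Common s]: the independent set [s] has a
    common neighbour x_m. *)
Inductive refutation :=
  | Count of seq nat
  | Hit of nat
  | Target of seq nat
  | Cut of seq nat & refutation & refutation
  | Branch of nat & nat & refutation & refutation
  | Common of seq nat & refutation.

Definition linked (E : seq (nat * nat)) (i j : nat) : bool :=
  ((i, j) \in E) || ((j, i) \in E).

(** The independent sets of the configuration, hence all possible traces of a
    neighbourhood on it. *)
Fixpoint traces (E : seq (nat * nat)) (m : nat) : seq (seq nat) :=
  if m is m'.+1 then
    let ss := traces E m' in
    let B := [seq i <- iota 0 m' | linked E m' i] in
    ss ++ [seq m' :: s | s <- ss & ~~ has (mem B) s]
  else [:: [::]].

Definition weight (c s : seq nat) : nat := sumn [seq nth 0 c i | i <- s].

Definition spokes (m : nat) (s : seq nat) : seq (nat * nat) :=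
  [seq (m, i) | i <- s].

(** A common neighbour certifies non-adjacency, because there are no triangles. *)
Definition apart (E N : seq (nat * nat)) (m i j : nat) : bool :=
  linked N i j || has (fun l => linked E l i && linked E l j) (iota 0 m).

Fixpoint refutes (r : nat) (K : seq (nat * nat)) (t : refutation) (m : nat)
    (E N : seq (nat * nat)) (F : seq (seq nat)) : bool :=
  match t with
  | Count c =>
      all (fun s => has (all (mem s)) F ||
                    (14 * weight c s < 5 * weight c (iota 0 m)))
          (traces E m)
  | Hit v => has (all (linked E v)) F
  | Target s => all (fun e => linked E (nth 0 s e.1) (nth 0 s e.2)) K
  | Cut s t1 t2 =>
      [&& all (gtn m) s, refutes r K t1 m.+1 (spokes m s ++ E) N F
        & refutes r K t2 m E N (s :: F)]
  | Branch i j t1 t2 =>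
      [&& i < m, j < m, refutes r K t1 m ((i, j) :: E) N F
        & refutes r K t2 m E ((i, j) :: N) F]
  | Common s t1 =>
      [&& all (gtn m) s, size s <= r, pairwise (apart E N m) s
        & refutes r K t1 m.+1 (spokes m s ++ E) N F]
  end.

Definition embeds (T : finType) (G : sgraph T) (K : seq (nat * nat))
    (x : nat -> T) : Prop :=
  {in K, forall e, G (x e.1) (x e.2)}.

Definition common_nbr (T : finType) (G : sgraph T) (r : nat) : Prop :=
  forall s : seq T, size s <= r -> pairwise (fun u v => ~~ G u v) s ->
  exists v, all (G v) s.

(** Indices decrease, to match the lists produced by [traces]. *)
Definition trace (T : finType) (G : sgraph T) (x : nat -> T) (v : T) (m : nat) :=
  [seq i <- rev (iota 0 m) | G v (x i)].

(** * Soundness of refutations *)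

Section Soundness.
Variables (T : finType) (G : sgraph T).
Hypothesis G_tf : triangle_free G.
Hypothesis G_deg : forall v, 5 * #|T| <= 14 * degree G v.

Lemma linked_adj E x i j : embeds G E x -> linked E i j -> G (x i) (x j).
Proof. by move=> Ex /orP[/Ex//|/Ex]; rewrite adj_sym. Qed.

Lemma trace_in E x v m : embeds G E x -> trace G x v m \in traces E m.
Proof.
move=> Ex; elim: m => [|m IHm] //=.
rewrite mem_cat /trace -addn1 iotaD rev_cat /= add0n; case: ifP => [vm|_]; last by rewrite IHm.
apply/orP; right; apply: map_f; rewrite mem_filter IHm andbT.
apply/hasPn => i; rewrite mem_filter => /andP[vi _]; rewrite /= mem_filter.
apply/negP => /andP[/(linked_adj Ex) mi _].
by have := G_tf v (x m) (x i); rewrite vm mi adj_sym vi.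
Qed.

Lemma weight_trace c x v m :
  weight c (trace G x v m) = \sum_(i < m) nth 0 c i * G v (x i).
Proof.
rewrite /weight sumnE big_map big_filter (perm_big (iota 0 m)) /=; last by rewrite perm_rev.
rewrite -[m in iota 0 m]subn0 big_mkcond big_mkord.
by apply: eq_bigr => i _; case: (G v _); rewrite ?muln1 ?muln0.
Qed.

(** Double counting of the weighted edges between the [x i] and the whole graph. *)
Lemma weighted_degrees (c : seq nat) (x : nat -> T) (m : nat) :
  5 * #|T| * weight c (iota 0 m) <= 14 * \sum_v weight c (trace G x v m).
Proof.
have -> : weight c (iota 0 m) = \sum_(i < m) nth 0 c i.
  by rewrite /weight sumnE big_map -[m in iota 0 m]subn0 big_mkord.
under [X in _ <= 14 * X]eq_bigr do rewrite weight_trace.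
rewrite exchange_big /= !big_distrr /=; apply: leq_sum => i _.
rewrite -big_distrr /= mulnCA [leqLHS]mulnC leq_mul2l; apply/orP; right.
rewrite (leq_trans (G_deg (x i))) // leq_mul2l /=.
rewrite /degree /neighbours -sum1dep_card big_mkcond /= leq_sum // => v _.
by rewrite adj_sym; case: (G v _).
Qed.

Lemma refutes_sound r K t :
  common_nbr G r -> ~ (exists y, embeds G K y) ->
  forall m (E N : seq (nat * nat)) (F : seq (seq nat)) x,
  {in E, forall e, (e.1 < m) && (e.2 < m)} ->
  {in N, forall e, (e.1 < m) && (e.2 < m)} ->
  {in F, forall s, all (gtn m) s} ->
  refutes r K t m E N F ->
  embeds G E x -> {in N, forall e, ~~ G (x e.1) (x e.2)} ->
  {in F, forall s v, ~~ all (fun i => G v (x i)) s} -> False.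
Proof.
move=> Gr noK.
(* The new vertex takes index m; earlier constraints only involve indices below m. *)
pose ext m v (x : nat -> T) i := if i == m then v else x i.
have ext_lt m v x i : i < m -> ext m v x i = x i by rewrite /ext; case: ltngtP.
have extE m v x s (E : seq (nat * nat)) : all (gtn m) s -> all (fun i => G v (x i)) s ->
    {in E, forall e, (e.1 < m) && (e.2 < m)} -> embeds G E x ->
    embeds G (spokes m s ++ E) (ext m v x) /\
    {in spokes m s ++ E, forall e, (e.1 < m.+1) && (e.2 < m.+1)}.
  move=> /allP sm /allP vs Em Ex; split=> e; rewrite mem_cat => /orP[/mapP[i si ->]|eE] /=.
  - by rewrite {1}/ext eqxx ext_lt ?vs //; apply: sm.
  - by have /andP[e1 e2] := Em _ eE; rewrite !ext_lt ?Ex.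
  - by rewrite ltnS leqnn leqW //; apply: sm.
  - by have /andP[e1 e2] := Em _ eE; rewrite !leqW.
have ext_step m v x s (E N : seq (nat * nat)) (F : seq (seq nat)) :
    all (gtn m) s -> all (fun i => G v (x i)) s ->
    {in E, forall e, (e.1 < m) && (e.2 < m)} ->
    {in N, forall e, (e.1 < m) && (e.2 < m)} ->
    {in F, forall s, all (gtn m) s} -> embeds G E x ->
    {in N, forall e, ~~ G (x e.1) (x e.2)} ->
    {in F, forall s v, ~~ all (fun i => G v (x i)) s} ->
    (forall x', {in spokes m s ++ E, forall e, (e.1 < m.+1) && (e.2 < m.+1)} ->
      {in N, forall e, (e.1 < m.+1) && (e.2 < m.+1)} ->
      {in F, forall s, all (gtn m.+1) s} ->
      embeds G (spokes m s ++ E) x' ->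
      {in N, forall e, ~~ G (x' e.1) (x' e.2)} ->
      {in F, forall s v, ~~ all (fun i => G v (x' i)) s} -> False) -> False.
  move=> sm vs Em Nm Fm Ex Nx Fx; have [Ex' Em'] := extE _ _ _ _ _ sm vs Em Ex.
  apply; [exact: Em' | | | exact: Ex' | |].
  - by move=> e /Nm /andP[e1 e2]; rewrite !leqW.
  - move=> f /Fm /allP fm; apply/allP => i /fm /= im; exact: leqW.
  - by move=> e eN; have /andP[e1 e2] := Nm _ eN; rewrite !ext_lt ?Nx.
  - move=> f fF u; apply: contra (Fx _ fF u) => /allP uf.
    apply/allP => i fi; have := uf _ fi; rewrite ext_lt //.
    by have /allP := Fm _ fF; apply.
elim: t => [c|v|s|s t1 IH1 t2 IH2|i j t1 IH1 t2 IH2|s t1 IH1] m E N F x Em Nm Fm /=.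
- move=> /allP cP Ex Nx Fx.
  have lt_v v : 14 * weight c (trace G x v m) < 5 * weight c (iota 0 m).
    have /orP[/hasP[f fF /allP fv]|//] := cP _ (trace_in v m Ex).
    case/negP: (Fx _ fF v); apply/allP => i fi.
    by have := fv _ fi; rewrite inE mem_filter => /andP[].
  have := weighted_degrees c x m; apply/negP; rewrite -ltnNge big_distrr /=.
  have -> : 5 * #|T| * weight c (iota 0 m) = \sum_(v : T) 5 * weight c (iota 0 m).
    by rewrite sum_nat_const mulnCA mulnA.
  (* Strictness of the sum needs at least one vertex, and [x 0] supplies it. *)
  rewrite (bigD1 (x 0)) //= [X in _ < X](bigD1 (x 0)) //= -addSn.
  by apply: leq_add => //; apply: leq_sum => v _; apply: ltnW.
- move=> /hasP[f fF /allP vf] Ex Nx /(_ _ fF (x v)); case/negP.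
  by apply/allP => i /vf /(linked_adj Ex).
- move=> /allP Ks Ex _ _; apply: noK; exists (fun i => x (nth 0 s i)) => e /Ks.
  exact: linked_adj.
- move=> /and3P[sm r1 r2] Ex Nx Fx.
  have [/existsP[v vs]|no_v] := boolP [exists v, all (fun i => G v (x i)) s].
    by apply: (ext_step _ _ _ _ _ _ _ sm vs Em Nm Fm Ex Nx Fx) => x' *;
      apply: (IH1 _ _ _ _ x' _ _ _ r1).
  apply: (IH2 _ _ _ _ x Em Nm _ r2) => // f; rewrite inE => /orP[/eqP-> //|].
  + exact: Fm.
  + by move=> v; apply: contra no_v => vs; apply/existsP; exists v.
  + exact: Fx.
- move=> /and4P[im jm r1 r2] Ex Nx Fx.
  have [ij|nij] := boolP (G (x i) (x j)).
    by apply: (IH1 _ _ _ _ x _ Nm Fm r1) => // e; rewrite inE => /orP[/eqP-> /=|];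
      rewrite ?im ?jm //; [apply: Em | apply: Ex].
  by apply: (IH2 _ _ _ _ x Em _ Fm r2) => // e; rewrite inE => /orP[/eqP-> /=|];
      rewrite ?im ?jm //; [apply: Nm | apply: Nx].
- move=> /and4P[sm sr s_apart r1] Ex Nx Fx.
  have [||v] := Gr (map x s); first by rewrite size_map.
    rewrite pairwise_map; apply: sub_pairwise s_apart => i j /orP[|/hasP[l _ /andP[li lj]]].
      by case/orP => /Nx //=; rewrite adj_sym.
    apply/negP => ij; have := G_tf (x l) (x i) (x j).
    by rewrite ij (linked_adj Ex li) adj_sym (linked_adj Ex lj).
  rewrite all_map => vs.
  by apply: (ext_step _ _ _ _ _ _ _ sm vs Em Nm Fm Ex Nx Fx) => x' *;
      apply: (IH1 _ _ _ _ x' _ _ _ r1).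
Qed.

End Soundness.

(** * Homomorphisms to Andrasfai graphs *)

(** An independent triple 0, 1, 2 without a common neighbour. Vertices 3, 4, 5
    are adjacent to two of these, 6 is adjacent to 3, 4, 5, and 7, 8, 9 join the
    opposite pairs of the hexagon. The weights of this and the following
    certificates come from linear programming. *)
Definition hexagon_refutation : refutation :=
  Common [:: 1; 2]
  (Common [:: 0; 2]
   (Common [:: 0; 1]
    (Cut [:: 3; 4; 5]
     (Branch 0 3
      (Hit 3)
      (Common [:: 0; 3]
       (Branch 1 4
        (Hit 4)
        (Common [:: 1; 4]
         (Branch 2 5
          (Hit 5)
          (Common [:: 2; 5]
           (Cut [:: 3; 8; 9]
            (Cut [:: 5; 7; 8]
             (Count [:: 2; 2; 2; 2; 3; 2; 1; 1; 2; 1; 1; 1])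
             (Cut [:: 4; 7; 9]
              (Count [:: 2; 2; 2; 2; 2; 3; 1; 1; 1; 2; 1; 1])
              (Cut [:: 2; 5; 8]
               (Count [:: 1; 1; 2; 2; 2; 2; 1; 1; 2; 1; 1; 1])
               (Count [:: 2; 3; 2; 1; 2; 3; 0; 1; 2; 1; 0]))))
            (Cut [:: 5; 7; 8]
             (Cut [:: 0; 3; 8]
              (Count [:: 2; 1; 1; 2; 2; 2; 1; 1; 2; 1; 1; 1])
              (Count [:: 2; 3; 2; 3; 2; 1; 0; 1; 2; 0; 1]))
             (Cut [:: 0; 3; 9]
              (Count [:: 3; 2; 2; 3; 2; 3; 1; 2; 2; 2; 1])
              (Count [:: 2; 2; 3; 3; 1; 2; 0; 1; 1; 2]))))))))))
     (Count [:: 1; 1; 1; 1; 1; 1])))).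

(** The independent sets of fewer than k vertices of the Andrasfai graph on
    3k-1 vertices, up to its dihedral symmetries, each with a refutation of the
    configuration in which vertex 3k-1 has exactly these neighbours. *)
Definition deficient (k : nat) : seq (seq nat * refutation) :=
  match k with
  | 1 =>
    [:: ([::],
      Common [:: 0; 2]
      (Common [:: 1; 2]
       (Target [:: 4; 3; 1; 2; 0])))]
  | 2 =>
    [:: ([::],
      Common [:: 0; 1; 5]
      (Common [:: 2; 3; 5]
       (Cut [:: 1; 2; 5]
        (Target [:: 8; 7; 0; 1; 5; 2; 3; 6])
        (Cut [:: 4; 6; 7]
         (Target [:: 8; 2; 3; 6; 4; 7; 0; 1])
         (Count [:: 0; 1; 1; 0; 1; 1; 1; 1])))));
     ([:: 0],
      Common [:: 1; 5]
      (Common [:: 3; 4; 5]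
       (Cut [:: 0; 4; 6]
        (Target [:: 8; 1; 7; 0; 6; 4; 3; 5])
        (Cut [:: 1; 2; 5]
         (Target [:: 8; 0; 7; 1; 2; 5; 3; 4])
         (Count [:: 1; 1; 1; 0; 1; 1; 1; 0])))))]
  | 3 =>
    [:: ([::],
      Common [:: 0; 1; 8]
      (Common [:: 3; 5; 8]
       (Common [:: 0; 6; 8]
        (Common [:: 6; 9; 10]
         (Count [:: 1; 2; 1; 1; 1; 2; 2; 1; 1; 1; 2; 1; 1])))));
     ([:: 0],
      Common [:: 1; 7; 8]
      (Common [:: 0; 2; 9]
       (Common [:: 0; 6; 9]
        (Count [:: 2; 2; 2; 1; 1; 1; 2; 2; 0; 2; 1; 1]))));
     ([:: 0; 1],
      Common [:: 2; 3; 8]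
      (Common [:: 5; 7; 8]
       (Branch 6 10
        (Cut [:: 0; 1; 7; 9]
         (Target [:: 11; 3; 2; 10; 1; 0; 9; 7; 6; 5; 8])
         (Cut [:: 2; 3; 4; 8]
          (Target [:: 11; 0; 1; 10; 2; 3; 4; 8; 5; 6; 7])
          (Count [:: 1; 2; 2; 1; 2; 1; 1; 2; 2; 2; 1])))
        (Common [:: 4; 6; 10]
         (Count [:: 2; 1; 2; 2; 1; 2; 2; 1; 1; 1; 1; 1])))));
     ([:: 0; 2],
      Common [:: 1; 3; 8]
      (Common [:: 1; 7; 8]
       (Count [:: 2; 2; 2; 2; 1; 1; 1; 2; 2; 1; 1])))]
  | 4 =>
    [:: ([::],
      Common [:: 0; 1; 11]
      (Common [:: 4; 7; 11]
       (Common [:: 6; 9; 11]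
        (Count [:: 1; 2; 0; 1; 2; 1; 1; 1; 2; 1; 1; 1; 1; 1; 1]))));
     ([:: 0],
      Common [:: 1; 9; 11]
      (Common [:: 0; 8; 12]
       (Count [:: 2; 1; 2; 2; 1; 1; 2; 2; 1; 2; 2; 0; 1; 1])));
     ([:: 0; 1],
      Common [:: 2; 10; 11]
      (Count [:: 2; 2; 1; 1; 2; 1; 1; 1; 2; 1; 1; 1; 1]));
     ([:: 0; 2],
      Common [:: 1; 3; 11]
      (Count [:: 1; 2; 2; 1; 1; 2; 1; 1; 1; 2; 1; 1; 1]));
     ([:: 0; 3],
      Common [:: 1; 4; 11]
      (Count [:: 1; 2; 2; 2; 1; 2; 2; 1; 1; 2; 2; 1; 1]));
     ([:: 0; 1; 2],
      Common [:: 3; 4; 11]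
      (Common [:: 7; 10; 11]
       (Branch 6 12
        (Branch 5 12
         (Cut [:: 7; 8; 9; 10; 11]
          (Target [:: 14; 2; 1; 0; 12; 10; 9; 8; 7; 11; 6; 5; 4; 3])
          (Count [:: 1; 1; 1; 1; 1; 1; 1; 1; 1; 1; 2; 2; 1; 2]))
         (Common [:: 5; 12]
          (Count [:: 1; 1; 1; 1; 1; 2; 1; 1; 1; 1; 1; 1; 2; 1; 1])))
        (Common [:: 6; 12]
         (Common [:: 6; 12; 13]
          (Count [:: 2; 2; 2; 1; 2; 2; 2; 1; 2; 2; 1; 1; 1; 1; 0; 1]))))));
     ([:: 0; 1; 3],
      Common [:: 2; 4; 11]
      (Count [:: 1; 1; 3; 2; 1; 1; 2; 1; 1; 1; 2; 2; 2]))]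
  | _ => [::]
  end.

(** For k > 0 the truncated subtraction lists each edge once, with i < j. *)
Definition andrasfai (k : nat) : seq (nat * nat) :=
  let n := (3 * k).-1 in
  [seq e <- [seq (i, j) | i <- iota 0 n, j <- iota 0 n] | k <= e.2 - e.1 <= (2 * k).-1].

(** Rotation by [p.1], preceded by the reflection i -> -i if [p.2] is false. *)
Definition turn (k : nat) (p : nat * bool) (i : nat) : nat :=
  let n := (3 * k).-1 in (p.1 + if p.2 then i else n - i) %% n.

Definition turns (k : nat) : seq (nat * bool) :=
  [seq (r, b) | r <- iota 0 (3 * k).-1, b <- [:: true; false]].

Definition turns_ok (k : nat) : bool :=
  let E := andrasfai k in
  all (fun p => all (fun e => linked E (turn k p e.1) (turn k p e.2)) E) (turns k).

Definition deficient_ok (k : nat) : bool :=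
  let n := (3 * k).-1 in
  all (fun c => all (gtn n) c.1 &&
    refutes 3 (andrasfai k.+1) c.2 n.+1 (spokes n c.1 ++ andrasfai k)
      (spokes n [seq i <- iota 0 n | i \notin c.1]) [::]) (deficient k).

Definition traces_ok (k : nat) : bool :=
  let n := (3 * k).-1 in
  all (fun s => (size s == k) ||
    has (fun c => has (fun p => all (fun i => (turn k p i \in s) == (i \in c.1)) (iota 0 n))
      (turns k)) (deficient k)) (traces (andrasfai k) n).

(** This lets a trace of size k single out a vertex j, the class of the vertex traced. *)
Definition stars_ok (k : nat) : bool :=
  let n := (3 * k).-1 in let E := andrasfai k in
  all (fun s => (size s != k) ||
    has (fun j => all (fun i => (i \in s) == linked E j i) (iota 0 n))
      (iota 0 n)) (traces E n).

Section Classes.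
Variables (T : finType) (G : sgraph T).
Hypothesis G_tf : triangle_free G.
Hypothesis G_deg : forall v, 5 * #|T| <= 14 * degree G v.

Lemma common_nbr3 : common_nbr G 2 -> common_nbr G 3.
Proof.
move=> G2 s; rewrite leq_eqVlt => /orP[/eqP|]; last by rewrite ltnS; apply: G2.
case: s => [|a [|b [|c []]]] //= _; rewrite !andbT => /andP[/andP[ab ac] bc].
pose x i := nth a [:: a; b; c] i.
apply: NNPP => no_v.
(* The target is a loop, which never embeds. *)
apply: (@refutes_sound _ _ G_tf G_deg 2 [:: (0, 0)] hexagon_refutation G2 _ 3 [::]
  [:: (0, 1); (0, 2); (1, 2)] [:: [:: 0; 1; 2]] x) => //.
- by case=> y /(_ (0, 0)); rewrite inE eqxx /= adj_irr => /(_ isT).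
- by move=> e; rewrite !inE => /or3P[] /eqP->.
- by move=> f; rewrite inE => /eqP->.
- by move=> e; rewrite !inE => /or3P[] /eqP->.
- move=> f; rewrite inE => /eqP-> v; apply/negP => /= /and4P[va vb vc _].
  by apply: no_v; exists v; rewrite /= va vb vc.
Qed.

Lemma mem_trace x v m i : (i \in trace G x v m) = (i < m) && G v (x i).
Proof. by rewrite mem_filter mem_rev mem_iota andbC. Qed.

(** A trace of any other size is, up to a symmetry, one of the [deficient] sets, each of which is
    refuted. *)
Lemma full_trace k h v : 0 < k < 5 -> common_nbr G 3 -> embeds G (andrasfai k) h ->
  ~ (exists y, embeds G (andrasfai k.+1) y) ->
  size (trace G h v (3 * k).-1) = k.
Proof.
move=> k_bd G3 hG noK; set n := (3 * k).-1.
have /and3P[turnsP certP traceP] : [&& turns_ok k, deficient_ok k & traces_ok k].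
  have : all (fun k => [&& turns_ok k, deficient_ok k & traces_ok k]) (iota 1 4).
    by vm_compute.
  by move/allP; apply; rewrite mem_iota.
have := allP traceP _ (trace_in G_tf v n hG).
case/orP=> [/eqP //|]; case/(has_nthP ([::], Hit 0)) => l l_lt.
set c := nth _ _ l; case/hasP=> p pT /allP cp.
exfalso; have /andP[c_lt c_ref] := all_nthP ([::], Hit 0) certP _ l_lt.
rewrite -/c -/n in c_lt c_ref.
have p_lt i : turn k p i < n by rewrite ltn_mod; lia.
(* The symmetry carries the listed set to the trace of [v], and [v] itself gets index n. *)
pose x i := if i == n then v else h (turn k p i).
have hp : embeds G (andrasfai k) (h \o turn k p).
  move=> e eE; apply: linked_adj hG _.
  exact: (allP (allP turnsP _ pT)).
have K_lt e : e \in andrasfai k -> (e.1 < n) && (e.2 < n).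
  rewrite mem_filter => /andP[_ /allpairsP[[i j] [/= i_n j_n ->]]] /=.
  by move: i_n j_n; rewrite !mem_iota !add0n => /andP[_ ->] /andP[_ ->].
have x_lt i : i < n -> x i = h (turn k p i) by rewrite /x; case: ltngtP.
have x_n i : i < n -> G (x n) (x i) = (i \in c.1).
  move=> i_n; rewrite (x_lt _ i_n) /x eqxx.
  by have := cp i; rewrite mem_iota i_n mem_trace p_lt /= => /(_ isT) /eqP.
apply: (@refutes_sound _ _ G_tf G_deg 3 (andrasfai k.+1) c.2 G3 noK n.+1
  _ _ [::] x _ _ _ c_ref) => //.
- move=> e; rewrite mem_cat => /orP[/mapP[i /(allP c_lt) /= i_n ->]|/K_lt /andP[e1 e2]] /=.
    by rewrite ltnS leqnn leqW.
  by rewrite !leqW.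
- move=> e /mapP[i]; rewrite mem_filter mem_iota => /andP[_ i_n] -> /=.
  by rewrite ltnS leqnn leqW.
- move=> e; rewrite mem_cat => /orP[/mapP[i ic ->]|eE] /=.
    by rewrite x_n //; apply: (allP c_lt).
  by have /andP[e1 e2] := K_lt _ eE; rewrite !x_lt //; apply: hp.
- move=> e /mapP[i]; rewrite mem_filter mem_iota => /andP[ic i_n] -> /=.
  by rewrite x_n.
Qed.

(** Here 5/14 fits exactly: a vertex has on average at least 5 neighbours among the 14, and never
    more than 5, so always 5. *)
Lemma full_trace5 h v : embeds G (andrasfai 5) h -> size (trace G h v 14) = 5.
Proof.
move=> hG; pose c := nseq 14 1.
have tP u : (size (trace G h u 14) == 5) || (weight c (trace G h u 14) <= 4).
  have : all (fun s => (size s == 5) || (weight c s <= 4)) (traces (andrasfai 5) 14).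
    by vm_compute.
  by move/allP; apply; apply: trace_in.
have w5 u : weight c (trace G h u 14) <= 5.
  have : all (fun s => weight c s <= 5) (traces (andrasfai 5) 14) by vm_compute.
  by move/allP; apply; apply: trace_in.
have c14 : weight c (iota 0 14) = 14 by [].
have := weighted_degrees G_deg c h 14; rewrite c14 [X in X <= _]mulnC leq_pmul2l // (bigD1 v) //=.
have /orP[/eqP //|lt5] := tP v; move=> le_sum.
have le_rest : \sum_(i | i != v) weight c (trace G h i 14) <= #|T|.-1 * 5.
  by rewrite -(cardC1 v) -sum_nat_const; apply: leq_sum.
have T_gt0 : 0 < #|T| by apply/card_gt0P; exists v.
have absurd N : 0 < N -> ~ 5 * N <= 4 + N.-1 * 5 by lia.
by case: (absurd _ T_gt0); apply: leq_trans le_sum (leq_add lt5 le_rest).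
Qed.

Lemma andrasfai_classes : 0 < #|T| -> common_nbr G 2 ->
  exists k (cls : T -> nat),
  [/\ 0 < k < 6, forall v, cls v < (3 * k).-1,
      forall u v, G u v -> linked (andrasfai k) (cls u) (cls v)
    & forall i, i < (3 * k).-1 ->
      5 * #|T| <= 14 * #|[set v | linked (andrasfai k) i (cls v)]|].
Proof.
move=> T_gt0 G2; have G3 := common_nbr3 G2.
have [k [h [k_bd hG full]]] : exists k h,
    [/\ 0 < k < 6, embeds G (andrasfai k) h & forall v, size (trace G h v (3 * k).-1) = k].
  pose has_and k := exists h, embeds G (andrasfai k) h.
  apply: NNPP => none.
  (* An embedding that cannot be enlarged would have full traces, contrary to [none]. *)
  have up k : 0 < k < 5 -> has_and k -> has_and k.+1.
    move=> k_bd [h hG]; apply: NNPP => noK; apply: none; exists k, h; split=> //; first lia.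
    by move=> v; apply: full_trace.
  have and1 : has_and 1.
    have /card_gt0P[v _] := T_gt0.
    have : 0 < degree G v by have := G_deg v; lia.
    case/card_gt0P => w; rewrite inE => vw.
    by exists (nth v [:: v; w]) => e; rewrite inE => /eqP->.
  have [h hG] : has_and 5 by apply: (up 4) (up 3 _ (up 2 _ (up 1 _ and1))).
  by apply: none; exists 5, h; split=> // v; apply: full_trace5.
set n := (3 * k).-1 in full *; set K := andrasfai k in hG *.
have star v : exists2 j, j < n & forall i, i < n -> G v (h i) = linked K j i.
  have : all stars_ok (iota 1 5) by vm_compute.
  move/allP/(_ k); rewrite mem_iota => /(_ k_bd) /allP /(_ _ (trace_in G_tf v n hG)).
  rewrite full eqxx /= => /hasP[j]; rewrite mem_iota => j_n /allP jP.
  by exists j => // i i_n; have := jP i; rewrite mem_iota mem_trace i_n => /(_ isT) /eqP.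
have [cls clsP] : exists cls : T -> nat,
    forall v, cls v < n /\ forall i, i < n -> G v (h i) = linked K (cls v) i.
  pose P v (j : 'I_n) := [forall i : 'I_n, G v (h i) == linked K j i].
  have exP v : exists j, P v j.
    have [j j_n jP] := star v; exists (Ordinal j_n); apply/forallP => i; apply/eqP; exact: jP.
  exists (fun v => val (xchoose (exP v))) => v; split=> [|i i_n]; first exact: ltn_ord.
  by have /forallP /(_ (Ordinal i_n)) /eqP := xchooseP (exP v).
exists k, cls; split=> // [v|u v uv|i i_n]; first by case: (clsP v).
- have [[u_n uP] [v_n vP]] := (clsP u, clsP v).
  have [//|/negP no_l] := boolP (linked K (cls u) (cls v)).
  (* Non-adjacent vertices of the Andrasfai graph, equal ones included, have a common neighbour l;
     then [h l] closes a triangle with [u] and [v]. *)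
  have : all (fun k => let n := (3 * k).-1 in let E := andrasfai k in
    all (fun i => all (fun j => linked E i j ||
      has (fun l => linked E i l && linked E j l) (iota 0 n)) (iota 0 n)) (iota 0 n))
    (iota 1 5) by vm_compute.
  move/allP/(_ k); rewrite mem_iota => /(_ k_bd) /allP /(_ (cls u)).
  rewrite mem_iota => /(_ u_n) /allP /(_ (cls v)); rewrite mem_iota => /(_ v_n).
  case/orP=> // /hasP[l]; rewrite mem_iota => l_n.
  rewrite -[andrasfai k]/K -uP // -vP // => /andP[ul vl].
  by have := G_tf u v (h l); rewrite uv vl adj_sym ul.
- suff -> : [set v | linked K i (cls v)] = neighbours G (h i) by apply: G_deg.
  apply/setP => v; rewrite !inE adj_sym; have [_ ->] := clsP v => //.
  by rewrite /linked orbC.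
Qed.

End Classes.

(** * Arcs of colour classes *)

(** Joining a non-adjacent pair without common neighbour creates no triangle and leaves fewer
    non-adjacent pairs. *)
Lemma saturation (T : finType) (G : sgraph T) : triangle_free G ->
  exists H : sgraph T, [/\ triangle_free H, forall u v, G u v -> H u v
    & forall u v, u != v -> ~~ H u v -> exists w, H w u && H w v].
Proof.
have [b] := ubnP #|[set p : T * T | ~~ G p.1 p.2]|.
elim: b G => // b IHb G; rewrite ltnS => G_b G_tf.
have [/existsP[u /existsP[v /and3P[uv nuv /existsPn no_w]]]|sat] :=
  boolP [exists u, exists v, [&& u != v, ~~ G u v & ~~ [exists w, G w u && G w v]]]; last first.
  exists G; split=> // u v uv nuv; apply/existsP; apply: contraR sat => no_w.
  by apply/existsP; exists u; apply/existsP; exists v; rewrite uv nuv.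
pose new x y := (x == u) && (y == v) || (x == v) && (y == u).
pose e x y := G x y || new x y.
have e_sym : symmetric e.
  move=> x y; rewrite /e /new adj_sym; congr (_ || _).
  by rewrite orbC; congr (_ || _); rewrite andbC.
have e_irr : irreflexive e.
  move=> x; rewrite /e /new adj_irr /= andbC orbb; apply/negP => /andP[/eqP-> /eqP vu].
  by rewrite vu eqxx in uv.
have no_triangle z : e v z -> e z u -> False.
  move=> vz zu; have z_u : z != u by apply: contraTneq zu => ->; rewrite e_irr.
  have z_v : z != v by apply: contraTneq vz => ->; rewrite e_irr.
  move: vz zu; rewrite /e /new (negbTE z_u) (negbTE z_v) !andbF !orbF => vz zu.
  by case/negP: (no_w z); rewrite zu adj_sym vz.
have new_triangle x y z : new x y -> e y z -> e z x -> False.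
  case/orP=> /andP[/eqP-> /eqP->]; first exact: no_triangle.
  by rewrite e_sym [e z v]e_sym => zu vz; apply: (no_triangle z).
have [||H [H_tf GH H_sat]] := IHb (SGraph e_sym e_irr).
- apply: leq_trans G_b; apply: proper_card; apply/properP; split.
    by apply/subsetP => p; rewrite !inE /= /e negb_or => /andP[].
  by exists (u, v); rewrite !inE //= /e /new !eqxx /= orbT.
- move=> x y z; apply/negP => /and3P[/= xy yz zx].
  have [xy_new|xy_old] := boolP (new x y); first exact: new_triangle xy_new yz zx.
  have [yz_new|yz_old] := boolP (new y z); first exact: new_triangle yz_new zx xy.
  have [zx_new|zx_old] := boolP (new z x); first exact: new_triangle zx_new xy yz.
  move: xy yz zx; rewrite /e (negbTE xy_old) (negbTE yz_old) (negbTE zx_old) !orbF => xy yz zx.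
  by have := G_tf x y z; rewrite xy yz zx.
by exists H; split=> // x y xy; apply: GH; rewrite /= /e xy.
Qed.

Lemma subset_of_card (T : finType) (A : {set T}) (c : nat) :
  c <= #|A| -> exists2 B : {set T}, B \subset A & #|B| = c.
Proof.
case/card_geqP => s [s_uniq s_size sA]; exists [set x in s].
  by apply/subsetP => x; rewrite inE; apply: sA.
by rewrite cardsE (card_uniqP s_uniq).
Qed.

Lemma card_initial (T : finType) (p : T -> nat) (k : nat) :
  #|[set v | p v < k]| = \sum_(t < k) #|[set v | p v == t]|.
Proof.
elim: k => [|k IHk]; first by rewrite big_ord0; apply: eq_card0 => v; rewrite inE.
rewrite big_ord_recr /= -IHk -cardsUI [X in _ + X](_ : _ = 0) ?addn0.
  by apply: eq_card => v; rewrite !inE ltnS leq_eqVlt orbC.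
by apply: eq_card0 => v; rewrite !inE; case: ltngtP.
Qed.

(** The set fills the classes p = 0, 1, ..., k+1 in this order, up to m vertices. *)
Lemma arc_half (T : finType) (G : sgraph T) (p : T -> nat) (k m : nat) :
  let w t := #|[set v | p v == t]| in let a := \sum_(t < k) w t in
  (forall u v, G u v -> p u <= p v -> p u + k <= p v) ->
  m <= a + w k + w k.+1 ->
  exists S : {set T}, #|S| = m /\
    #|edges_in G S| <= w 0 * (m - a) + w 1 * (m - a - w k).
Proof.
move=> w a far m_le.
have aE : #|[set v | p v < k]| = a by apply: card_initial.
have [|U /subsetP Uk U_card] := @subset_of_card _ [set v | p v < k] (minn m a).
  by rewrite aE geq_minr.
have [|X /subsetP Xk X_card] := @subset_of_card _ [set v | p v == k] (minn (m - a) (w k)).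
  exact: geq_minr.
have [|Y /subsetP Yk Y_card] := @subset_of_card _ [set v | p v == k.+1] (m - a - w k).
  by rewrite -/(w k.+1); lia.
have pU v : v \in U -> p v < k by move/Uk; rewrite inE.
have pX v : v \in X -> p v = k by move/Xk; rewrite inE => /eqP.
have pY v : v \in Y -> p v = k.+1 by move/Yk; rewrite inE => /eqP.
have UX0 : [disjoint U & X].
  by apply/pred0P => v /=; apply/negP => /andP[/pU vU /pX vX]; lia.
have UXY0 : [disjoint U :|: X & Y].
  apply/pred0P => v /=; apply/negP => /andP[]; rewrite inE => /orP[/pU|/pX] vU /pY vY; lia.
have XY0 : [disjoint X & Y].
  by apply/pred0P => v /=; apply/negP => /andP[/pX vX /pY vY]; lia.
have cardU2 (A B : {set T}) : [disjoint A & B] -> #|A :|: B| = #|A| + #|B|.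
  by move=> AB; rewrite cardsU (disjoint_setI0 AB) cards0 subn0.
exists (U :|: X :|: Y); split; first by rewrite !cardU2 // U_card X_card Y_card; lia.
pose P t := [set v | p v == t].
pose f (q : T * T) := [set q.1; q.2].
(* Among k + 2 consecutive classes, edges only join the first class to the last two, or the second
   to the last. *)
have sub : edges_in G (U :|: X :|: Y) \subset
    (f @: setX (P 0) (X :|: Y)) :|: (f @: setX (P 1) Y).
  apply/subsetP => e /imset2P[x y xS]; rewrite inE => /andP[yS xy] ->.
  wlog xy_le : x y xS yS xy / p x <= p y.
    have [le|/ltnW le] := leqP (p x) (p y); first exact.
    by rewrite (setUC [set x]) => IH; apply: (IH y x) => //; rewrite (adj_sym G).
  have y_far := far _ _ xy xy_le.
  rewrite !inE -!orbA in yS; case/or3P: yS => [/pU|yX|yY]; first lia.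
  - rewrite inE; apply/orP; left; apply/imsetP; exists (x, y) => //.
    by rewrite !inE /= yX /= andbT; have := pX _ yX; lia.
  - have /pY py := yY; have [x0|x1] := eqVneq (p x) 0.
      rewrite inE; apply/orP; left; apply/imsetP; exists (x, y) => //.
      by rewrite !inE /= yY x0 eqxx orbT.
    rewrite inE; apply/orP; right; apply/imsetP; exists (x, y) => //.
    by rewrite !inE /= yY andbT; lia.
apply: leq_trans (subset_leq_card sub) _.
apply: leq_trans (leq_card_setU _ _) _; apply: leq_add.
  apply: leq_trans (leq_imset_card _ _) _; rewrite cardsX leq_mul2l cardU2 // X_card Y_card.
  by apply/orP; right; lia.
by apply: leq_trans (leq_imset_card _ _) _; rewrite cardsX Y_card.
Qed.

(** * Cyclic sequences of class sizes *)

(** From 4abxy <= (ax + by)^2. This turns a quadratic bound into linear ones, which [lia] can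
    combine. *)
Lemma am_gm (a b c n x y : nat) : 0 < c -> 50 * (c * c) <= 4 * (a * b) ->
  n * n < 50 * (x * y) -> c * n < a * x + b * y.
Proof.
move=> c_gt0 abc nxy; rewrite ltnNge; apply/negP => le_cn.
have h1 : (a * x + b * y) * (a * x + b * y) <= (c * n) * (c * n) by apply: leq_mul.
have h2 : 4 * (a * b) * (x * y) <= (a * x + b * y) * (a * x + b * y).
  by rewrite -mulnA mulnACA mulnn nat_AGM2.
have h3 : 50 * (c * c) * (x * y) <= 4 * (a * b) * (x * y) by rewrite leq_mul2r abc orbT.
have := leq_trans h3 (leq_trans h2 h1).
rewrite [c * n * _]mulnACA [50 * _]mulnC -mulnA leq_pmul2l ?muln_gt0 ?c_gt0 //.
by rewrite leqNgt nxy.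
Qed.

Definition arcsum (w : nat -> nat) (s l : nat) : nat := sumn [seq w i | i <- iota s l].

Lemma arcsumS w s l : arcsum w s l.+1 = arcsum w s l + w (s + l).
Proof. by rewrite /arcsum -addn1 iotaD map_cat sumn_cat /= addn0. Qed.

(** No arc of m vertices starting with a full class is sparse: the right-hand
    side is the bound of [arc_half] for classes of sizes w s, w s.+1, ... *)
Definition dense_arcs (k n m : nat) (w : nat -> nat) : Prop :=
  forall s, m <= arcsum w s k.+2 ->
  n * n < 50 * (w s * (m - arcsum w s k) + w s.+1 * (m - arcsum w s k.+1)).

(** If k classes already hold m vertices, both terms of the bound vanish. *)
Lemma short_arc k n m w s : dense_arcs k n m w -> arcsum w s k < m.
Proof.
move=> F; rewrite ltnNge; apply/negP => le_m.
have : m <= arcsum w s k.+2 by rewrite !arcsumS; lia.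
move/F; rewrite arcsumS.
have -> : m - arcsum w s k = 0 by lia.
have -> : m - (arcsum w s k + w (s + k)) = 0 by lia.
by rewrite !muln0.
Qed.

Lemma tight_arc k n m w s : dense_arcs k n m w -> m <= arcsum w s k.+1 ->
  n * n < 50 * (w s * (m - arcsum w s k)).
Proof.
move=> F le_m; have : m <= arcsum w s k.+2 by rewrite arcsumS; lia.
move/F.
have -> : m - arcsum w s k.+1 = 0 by lia.
by rewrite muln0 addn0.
Qed.

(** Two consecutive classes have fewer than m vertices, so the other three have at least m and
    [step] applies at every start. Its sum over the five starts reads 25n < 50m. *)
Lemma no_dense_cycle2 n m w : 2 * m <= n -> (forall i, w (5 + i) = w i) ->
  arcsum w 0 5 = n -> ~ dense_arcs 2 n m w.
Proof.
move=> mn P W F.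
(* The coefficients give equality at class size n/5 and excess n/10, as in the balanced blow-up of
   the pentagon. *)
have step s : m <= arcsum w s 3 -> 2 * n < 5 * w s + 10 * (m - arcsum w s 2).
  by move=> le_m; apply: am_gm => //; apply: tight_arc F le_m.
have sh s := short_arc s F.
have w5 : w 5 = w 0 := P 0. have w6 : w 6 = w 1 := P 1. have w7 : w 7 = w 2 := P 2.
have {}P := (w5, w6, w7).
move: (sh 0) (sh 1) (sh 2) (sh 3) (sh 4) (step 0) (step 1) (step 2) (step 3) (step 4) W.
by rewrite /arcsum /= !P; lia.
Qed.

(** The first bound comes from y <= n/7, the others from [am_gm] with balance at x = y and at x =
    2y. Here y is the excess of m over three classes, which hold at least 5n/14 vertices. *)
Lemma good_arc n x y : 7 * y <= n -> n * n < 50 * (x * y) ->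
  [/\ 7 * n < 50 * x, 7 * n < 25 * x + 25 * y & 2 * n < 5 * x + 10 * y].
Proof.
move=> yn nxy; split; [|by apply: am_gm nxy|by apply: am_gm nxy].
have n_gt0 : 0 < n.
  rewrite lt0n; apply/eqP => n0; move: nxy; have -> : y = 0 by lia.
  by rewrite !muln0.
rewrite -(ltn_pmul2r n_gt0); apply: (@leq_trans (7 * (50 * (x * y)))).
  by rewrite -mulnA ltn_pmul2l.
by rewrite mulnCA -mulnA leq_mul2l /= mulnCA leq_mul2l yn orbT.
Qed.

(** Of the opposite arcs [s, s+3] and [s+4, s+7], one has at least m vertices.
    Both of its ends may then serve as starting points (w' is the mirror image
    of w), which bounds the two end classes from below and the two middle
    classes from above. All 16 choices of long arcs are contradictory. *)
Lemma no_dense_cycle3 n m w w' : 2 * m <= n -> (forall i, w (8 + i) = w i) ->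
  (forall i, w' (8 + i) = w' i) -> (forall i, i < 8 -> w' i = w (7 - i)) ->
  arcsum w 0 8 = n -> (forall s, 5 * n <= 14 * arcsum w s 3) ->
  ~ (dense_arcs 3 n m w /\ dense_arcs 3 n m w').
Proof.
move=> mn P P' ww' W D [F F'].
have w'0 : w' 0 = w 7 := ww' 0 isT.
have w'1 : w' 1 = w 6 := ww' 1 isT.
have w'2 : w' 2 = w 5 := ww' 2 isT.
have w'3 : w' 3 = w 4 := ww' 3 isT.
have w'4 : w' 4 = w 3 := ww' 4 isT.
have w'5 : w' 5 = w 2 := ww' 5 isT.
have w'6 : w' 6 = w 1 := ww' 6 isT.
have w'7 : w' 7 = w 0 := ww' 7 isT.
have w8 : w 8 = w 0 := P 0. have w'8 : w' 8 = w 7 := etrans (P' 0) w'0.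
have w9 : w 9 = w 1 := P 1. have w'9 : w' 9 = w 6 := etrans (P' 1) w'1.
have w10 : w 10 = w 2 := P 2. have w'10 : w' 10 = w 5 := etrans (P' 2) w'2.
have R := (w'0, w'1, w'2, w'3, w'4, w'5, w'6, w'7, w'8, w'9, w'10, w8, w9, w10).
have D' s : s < 8 -> 5 * n <= 14 * arcsum w' s 3.
  (* The mirror image of the three classes from s starts at 5 - s modulo 8. *)
  move=> s8; have := D (nth 0 [:: 5; 4; 3; 2; 1; 0; 7; 6] s).
  by do 8?[case: s s8 => [|s] //= s8]; rewrite /arcsum /= !R; lia.
have step s : m <= arcsum w s 4 -> [/\ 7 * n < 50 * w s, 7 * n < 25 * w s + 25 * (m - arcsum w s 3)
    & 2 * n < 5 * w s + 10 * (m - arcsum w s 3)].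
  by move=> le_m; apply: good_arc (tight_arc F le_m); have := D s; lia.
have step' s : s < 8 -> m <= arcsum w' s 4 -> [/\ 7 * n < 50 * w' s,
    7 * n < 25 * w' s + 25 * (m - arcsum w' s 3) & 2 * n < 5 * w' s + 10 * (m - arcsum w' s 3)].
  by move=> s8 le_m; apply: good_arc (tight_arc F' le_m); have := D' s s8; lia.
(* Here s' = 4 - s modulo 8 is where the mirror image of the four classes from s starts. *)
have good s s' : (s, s') \in [:: (0, 4); (1, 3); (2, 2); (3, 1); (4, 0); (5, 7); (6, 6); (7, 5)] ->
    m <= arcsum w s 4 ->
  [/\ 7 * n < 50 * w s, 7 * n < 25 * w s + 25 * (m - arcsum w s 3)
    & 2 * n < 5 * w s + 10 * (m - arcsum w s 3)] /\
  [/\ 7 * n < 50 * w s.+3, 7 * n < 25 * w s.+3 + 25 * (m - arcsum w s.+1 3)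
    & 2 * n < 5 * w s.+3 + 10 * (m - arcsum w s.+1 3)].
  move=> ss' le_m; split; first exact: step.
  have [s'8 e4 e3 e1] : [/\ s' < 8, arcsum w' s' 4 = arcsum w s 4,
      arcsum w' s' 3 = arcsum w s.+1 3 & w' s' = w s.+3].
    move: ss'; rewrite !inE !xpair_eqE /arcsum.
    do 8?[case/orP]; case/andP=> /eqP-> /eqP->; rewrite /= ?R; split=> //; lia.
  by have := step' s' s'8; rewrite e4 e3 e1; apply.
have opp s s' : (s, s') \in [:: (0, 4); (1, 5); (2, 6); (3, 7)] ->
    m <= arcsum w s 4 \/ m <= arcsum w s' 4.
  move=> ss'; suff : arcsum w s 4 + arcsum w s' 4 = n by lia.
  move: ss' W; rewrite !inE !xpair_eqE /arcsum.
  by do 4?[case/orP]; case/andP=> /eqP-> /eqP->; rewrite /= ?R; lia.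
case: (@opp 0 4 isT) => [/(@good 0 4 isT)|/(@good 4 0 isT)] [[a0 b0 c0] [d0 e0 f0]];
case: (@opp 1 5 isT) => [/(@good 1 3 isT)|/(@good 5 7 isT)] [[a1 b1 c1] [d1 e1 f1]];
case: (@opp 2 6 isT) => [/(@good 2 2 isT)|/(@good 6 6 isT)] [[a2 b2 c2] [d2 e2 f2]];
case: (@opp 3 7 isT) => [/(@good 3 1 isT)|/(@good 7 5 isT)] [[a3 b3 c3] [d3 e3 f3]];
move: W (D 0) (D 1) (D 2) (D 3) (D 4) (D 5) (D 6) (D 7)
  a0 b0 c0 d0 e0 f0 a1 b1 c1 d1 e1 f1
  a2 b2 c2 d2 e2 f2 a3 b3 c3 d3 e3 f3;
rewrite /arcsum /= !R; lia.
Qed.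

(** Summing [step] over all starts gives 14(3k - 1)n <= 150n, which fails once 3k - 1 >= 11. *)
Lemma no_dense_long_cycle k n m w : 3 < k -> 0 < n -> 2 * m <= n ->
  (forall i, w ((3 * k).-1 + i) = w i) ->
  (forall s, arcsum w s (3 * k).-1 = n) -> (forall s, 5 * n <= 14 * arcsum w s k) ->
  ~ dense_arcs k n m w.
Proof.
move=> k_gt3 n_gt0 mn P W D F.
have arcD s a b : arcsum w s (a + b) = arcsum w s a + arcsum w (s + a) b.
  by rewrite /arcsum iotaD map_cat sumn_cat.
have w_ge s : n <= 14 * w s.
  have := arcD s (3 * k).-1 1; rewrite W addn1 prednK ?muln_gt0 ?(ltn_trans _ k_gt3) //.
  rewrite [arcsum w _ 1]/arcsum /= addn0 addnC [s + _]addnC P.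
  have -> : 3 * k = k + (k + k) by lia.
  by rewrite !arcD; have := D s; have := D (s + k); have := D (s + k + k); lia.
(* The excess of m is at most n/7 over k classes and n/14 over k + 1 classes. *)
have step s : 14 * n < 50 * (2 * w s + w s.+1).
  have le_m : m <= arcsum w s k.+2.
    by rewrite !arcsumS; have := D s; have := w_ge (s + k); have := w_ge (s + k.+1); lia.
  have y_le : 14 * (m - arcsum w s k) <= 2 * n by have := D s; lia.
  have z_le : 14 * (m - arcsum w s k.+1) <= n.
    by rewrite arcsumS; have := D s; have := w_ge (s + k); lia.
  rewrite -(ltn_pmul2r n_gt0); apply: (@leq_trans (14 * (50 * (w s * (m - arcsum w s k)
      + w s.+1 * (m - arcsum w s k.+1))))).
    by rewrite -mulnA ltn_pmul2l //; apply: F.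
  rewrite mulnCA -mulnA leq_mul2l /= mulnDr mulnDl; apply: leq_add.
    by rewrite mulnCA [2 * _]mulnC -mulnA leq_mul2l y_le orbT.
  by rewrite mulnCA leq_mul2l z_le orbT.
have sums l : 14 * n * l <= 50 * (2 * arcsum w 0 l + arcsum w 1 l).
  elim: l => [|l IHl]; first by rewrite muln0.
  by rewrite !arcsumS add0n add1n; have := step l; lia.
have arc1 : arcsum w 1 (3 * k).-1 = n := W 1.
have := sums (3 * k).-1; rewrite W arc1.
have -> : 2 * n + n = 3 * n by lia.
apply/negP; rewrite -ltnNge mulnA [50 * _ * _]mulnC mulnAC [_ * n]mulnC ltn_pmul2l //; lia.
Qed.

(** * Class sizes of a coloured graph *)

(** The position of class i in the cyclic order starting with class s. *)
Definition rot (k s i : nat) : nat := (i + ((3 * k).-1 - s)) %% (3 * k).-1.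

Definition rot_ok (k : nat) : bool :=
  let n := (3 * k).-1 in let E := andrasfai k in
  all (fun s =>
    all (fun i => (linked E ((s + (2 * k).-1) %% n) i == (rot k s i < k)) &&
      all (fun t => (rot k s i == t) == (i == (s + t) %% n)) (iota 0 n)) (iota 0 n) &&
    all (fun e => if rot k s e.1 <= rot k s e.2 then rot k s e.1 + k <= rot k s e.2
      else rot k s e.2 + k <= rot k s e.1) E)
  (iota 0 n).

Definition mirror_ok (k : nat) : bool :=
  let n := (3 * k).-1 in let E := andrasfai k in
  all (fun e => linked E (n.-1 - e.1) (n.-1 - e.2)) E.

Lemma arcsumE w s l : arcsum w s l = \sum_(t < l) w (s + t).
Proof. by elim: l => [|l IHl]; rewrite ?big_ord0 // arcsumS IHl big_ord_recr. Qed.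

(** Vertex s + 2k - 1 sees exactly s, ..., s + k - 1, so arcs of k classes inherit the degree bound;
    the last clause is the hypothesis of [arc_half]. *)
Lemma rotP k s : 1 < k < 6 -> s < (3 * k).-1 ->
  [/\ forall i, i < (3 * k).-1 ->
        linked (andrasfai k) ((s + (2 * k).-1) %% (3 * k).-1) i = (rot k s i < k),
      forall i t, i < (3 * k).-1 -> t < (3 * k).-1 ->
        (rot k s i == t) = (i == (s + t) %% (3 * k).-1)
    & forall i j, linked (andrasfai k) i j -> rot k s i <= rot k s j ->
        rot k s i + k <= rot k s j].
Proof.
move=> k_bd s_lt; have : all rot_ok (iota 2 4) by vm_compute.
move/allP/(_ k); rewrite mem_iota => /(_ k_bd) /allP /(_ s).
rewrite mem_iota => /(_ s_lt) /andP[/allP iP /allP eP]; split.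
- by move=> i i_lt; have := iP i; rewrite mem_iota => /(_ i_lt) /andP[/eqP].
- move=> i t i_lt t_lt; have := iP i; rewrite mem_iota => /(_ i_lt) /andP[_ /allP /(_ t)].
  by rewrite mem_iota => /(_ t_lt) /eqP.
- by move=> i j /orP[/eP|/eP] /=; case: ifP => //; lia.
Qed.

Section Cycle.
Variables (T : finType) (G : sgraph T) (k m : nat) (cls : T -> nat).
Hypothesis k_bd : 1 < k < 6.
Hypothesis cls_lt : forall v, cls v < (3 * k).-1.
Hypothesis cls_hom : forall u v, G u v -> linked (andrasfai k) (cls u) (cls v).

(** Reducing the index lets arcs run past the last class. *)
Definition class_size i := #|[set v | cls v == i %% (3 * k).-1]|.

Let n_gt0 : 0 < (3 * k).-1. Proof. lia. Qed.

Lemma class_size_mod i : class_size ((3 * k).-1 + i) = class_size i.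
Proof. by rewrite /class_size modnDl. Qed.

Lemma class_size_rot s t : t < (3 * k).-1 ->
  #|[set v | rot k (s %% (3 * k).-1) (cls v) == t]| = class_size (s + t).
Proof.
move=> t_lt; have [_ rP _] := rotP k_bd (ltn_pmod s n_gt0).
by apply: eq_card => v; rewrite !inE rP // modnDml.
Qed.

Lemma card_rot s l : l <= (3 * k).-1 ->
  #|[set v | rot k (s %% (3 * k).-1) (cls v) < l]| = arcsum class_size s l.
Proof.
move=> l_le; rewrite card_initial arcsumE; apply: eq_bigr => t _.
by rewrite class_size_rot // (leq_trans (ltn_ord t)).
Qed.

Lemma class_size_total s : arcsum class_size s (3 * k).-1 = #|T|.
Proof.
by rewrite -card_rot //; apply: eq_card => v; rewrite !inE ltn_mod n_gt0.
Qed.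

Lemma class_size_degree :
  (forall i, i < (3 * k).-1 -> 5 * #|T| <= 14 * #|[set v | linked (andrasfai k) i (cls v)]|) ->
  forall s, 5 * #|T| <= 14 * arcsum class_size s k.
Proof.
move=> deg s; have [iP _ _] := rotP k_bd (ltn_pmod s n_gt0).
rewrite -card_rot; last by lia.
apply: leq_trans (deg _ (ltn_pmod (s %% (3 * k).-1 + (2 * k).-1) n_gt0)) _.
rewrite leq_mul2l /=; apply: subset_leq_card; apply/subsetP => v.
by rewrite !inE iP.
Qed.

Lemma class_size_dense :
  (forall S : {set T}, #|S| = m -> #|T| * #|T| < 50 * #|edges_in G S|) ->
  dense_arcs k #|T| m class_size.
Proof.
move=> dense s le_m; have [_ _ eP] := rotP k_bd (ltn_pmod s n_gt0).
have sizes t : t < k.+2 ->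
    #|[set v | rot k (s %% (3 * k).-1) (cls v) == t]| = class_size (s + t).
  by move=> t_lt; apply: class_size_rot; lia.
have [||S [S_m S_e]] := @arc_half T G (fun v => rot k (s %% (3 * k).-1) (cls v)) k m _.
- by move=> u v /cls_hom; apply: eP.
- rewrite -card_initial card_rot; last by lia.
  by rewrite !sizes //; move: le_m; rewrite !arcsumS.
apply: leq_trans (dense S S_m) _; rewrite leq_mul2l /=.
move: S_e; rewrite -card_initial card_rot; last by lia.
by rewrite !sizes // addn0 addn1 -subnDA -arcsumS.
Qed.

End Cycle.

Lemma linked_mirror k i j : 1 < k < 6 -> linked (andrasfai k) i j ->
  linked (andrasfai k) ((3 * k).-1.-1 - i) ((3 * k).-1.-1 - j).
Proof.
move=> k_bd; have : all mirror_ok (iota 2 4) by vm_compute.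
move/allP/(_ k); rewrite mem_iota => /(_ k_bd) /allP eP.
by case/orP=> /eP //=; rewrite /linked orbC.
Qed.

(** * Sparse halves of triangle-free graphs *)

Lemma saturated_sparse_half (T : finType) (G : sgraph T) : triangle_free G ->
  (forall v, 5 * #|T| <= 14 * degree G v) -> common_nbr G 2 -> 0 < #|T| ->
  exists2 S : {set T}, #|S| = #|T|./2 & 50 * #|edges_in G S| <= #|T| * #|T|.
Proof.
move=> G_tf G_deg G2 T_gt0; apply: NNPP => no_half; set m := #|T|./2 in no_half.
have dense (S : {set T}) : #|S| = m -> #|T| * #|T| < 50 * #|edges_in G S|.
  by move=> S_m; rewrite ltnNge; apply/negP => S_e; apply: no_half; exists S.
have mT : 2 * m <= #|T| by rewrite mul2n -[leqRHS]odd_double_half leq_addl.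
have [k [cls [k_bd cls_lt cls_hom cls_deg]]] := andrasfai_classes G_tf G_deg T_gt0 G2.
have [k1|k_neq1] := eqVneq k 1.
  (* For k = 1 the graph is bipartite, and one side has at least m vertices. *)
  subst k; pose I b := [set v | cls v == b :> nat].
  have indep (b : nat) (S : {set T}) : S \subset I b -> #|edges_in G S| = 0.
    move=> /subsetP SI; apply/eqP; rewrite cards_eq0; apply/eqP/setP => e; rewrite inE.
    apply/negP => /imset2P[x y xS]; rewrite inE => /andP[yS xy] _.
    have := cls_hom _ _ xy; move: (SI _ xS) (SI _ yS); rewrite !inE => /eqP-> /eqP->.
    by rewrite /linked mem_filter subnn.
  have : m <= #|I 0| \/ m <= #|I 1|.
    have : #|T| <= #|I 0| + #|I 1|.
      rewrite -cardsT; apply: leq_trans (leq_card_setU _ _); apply: subset_leq_card.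
      by apply/subsetP => v _; rewrite !inE; have := cls_lt v; case: (cls v) => [|[]].
    lia.
  by case=> /subset_of_card[S SI S_m]; have := dense S S_m; rewrite (indep _ _ SI).
have {k_neq1}k_bd : 1 < k < 6 by lia.
have P := @class_size_mod T k cls; have W := class_size_total k_bd cls_lt.
have D := class_size_degree k_bd cls_lt cls_deg.
have F := class_size_dense k_bd cls_lt cls_hom dense.
have [k4|k_lt4] := ltnP 3 k.
  exact: no_dense_long_cycle k4 T_gt0 mT P W D F.
have [k2|k3] : k = 2 \/ k = 3 by lia.
  by subst k; apply: no_dense_cycle2 mT P (W 0) F.
(* Reversing the cyclic order preserves adjacency, so the mirrored classes have dense arcs too. *)
subst k; pose cls' v := 7 - cls v.
have cls'_lt v : cls' v < 8 by rewrite /cls'; lia.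
have cls'_hom u v : G u v -> linked (andrasfai 3) (cls' u) (cls' v).
  by move/cls_hom/(linked_mirror k_bd).
have F' := class_size_dense k_bd cls'_lt cls'_hom dense.
apply: (@no_dense_cycle3 #|T| m _ _ mT P (@class_size_mod T 3 cls') _ (W 0) D (conj F F')).
move=> i i_lt; apply: eq_card => v; rewrite !inE (modn_small i_lt).
rewrite modn_small; last by lia.
by have := cls_lt v; rewrite /cls' => /= v_lt; apply/eqP/eqP; lia.
Qed.

Local Open Scope ring_scope.

Theorem theorem1p1 (n : nat) (T : finType) (G : sgraph T)
  (card_T : #|T| = n)
  (G_tf : triangle_free G)
  (G_deg : min_degree_ge G (5%:R / 14%:R * n%:R)) :
  exists S : {set T},
    #|S| = n./2 /\ (#|edges_in G S|%:R <= n%:R ^+ 2 / 50%:R :> rat).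
Proof.
subst n; have [T0|T_gt0] := posnP #|T|.
  exists set0; split; first by rewrite T0 cards0.
  have -> : edges_in G set0 = set0.
    by apply/setP => e; rewrite in_set0; apply/negP => /imset2P[x y]; rewrite in_set0.
  by rewrite cards0; apply: divr_ge0 (exprn_ge0 _ (ler0n _ _)) (ler0n _ _).
have [H [H_tf GH H_sat]] := saturation G_tf.
have H_deg v : (5 * #|T| <= 14 * degree H v)%N.
  have GHv : (degree G v <= degree H v)%N.
    by apply: subset_leq_card; apply/subsetP => w; rewrite !inE; apply: GH.
  apply: leq_trans (_ : 14 * degree G v <= _)%N; last by rewrite leq_mul2l.
  have := G_deg v; rewrite mulrAC ler_pdivrMr // -!natrM ler_nat mulnC [leqRHS]mulnC.
  by rewrite [X in (X <= _)%N]mulnC.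
have nbr v : exists w, H w v.
  have : (0 < degree H v)%N by have := H_deg v; lia.
  by case/card_gt0P => w; rewrite inE => vw; exists w; rewrite adj_sym.
(* Lists of length 0 and 1 need a vertex and positive degrees; a list of length 2 may repeat a
   vertex, outside the scope of [H_sat]. *)
have H2 : common_nbr H 2.
  case=> [|a [|b [|]]] // _ /=.
  - by move=> _; have /card_gt0P[v _] := T_gt0; exists v.
  - by move=> _; have [w wa] := nbr a; exists w; rewrite wa.
  - rewrite !andbT => ab; have [<-|a_neq] := eqVneq a b.
      by have [w wa] := nbr a; exists w; rewrite wa.
    by have [w /andP[wa wb]] := H_sat a b a_neq ab; exists w; rewrite wa wb.
have [S S_card S_e] := saturated_sparse_half H_tf H_deg H2 T_gt0.
exists S; split=> //; rewrite ler_pdivlMr // -natrM -natrX ler_nat mulnC expnS expn1.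
(* Every edge of [G] inside [S] is an edge of [H]. *)
apply: leq_trans S_e; rewrite leq_mul2l /=; apply: subset_leq_card.
apply/subsetP => e /imset2P[x y xS]; rewrite inE => /andP[yS xy] ->.
by apply/imset2P; exists x y; rewrite // inE yS GH.
Qed.
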